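(* Let $\mathbf{w}_\ast\in\mathbb{R}^d\setminus\{0\}$, let $\mathbf{x}_1,\dots,\mathbf{x}_n\in\mathbb{R}^d$, and let $y_i=\sigma(\mathbf{w}_\ast^\top\mathbf{x}_i)$ for $i=1,\dots,n$. Let $L^1:\mathbb{R}^d\to\mathbb{R}$ be the normalized cross-entropy loss of the data $(\mathbf{x}_i,y_i)_{i=1}^n$. Let $\mathbf{w}:[0,\infty)\to\mathbb{R}^d$ be the solution of the gradient flow $\frac{d}{d\tau}\mathbf{w}(\tau)=-\nabla L^1(\mathbf{w}(\tau))$ with initial value $\mathbf{w}(0)=\mathbf{w}_0\in\mathbb{R}^d$. Let $P_{\mathbf{X}}$ be the orthogonal projector of $\mathbb{R}^d$ onto $\operatorname{span}\{\mathbf{x}_1,\dots,\mathbf{x}_n\}$. Then, as $\tau\to\infty$, $\mathbf{w}(\tau)$ converges to $$\hat{\mathbf{w}}=\mathbf{w}_0+P_{\mathbf{X}}(\mathbf{w}_\ast-\mathbf{w}_0).$$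
   Context: $\sigma(u)=1/(1+e^{-u})$ is the sigmoid function. The normalized cross-entropy loss is $$L^1(\mathbf{w})=-\frac1n\sum_{i=1}^n\Big[y_i\log\sigma(\mathbf{w}^\top\mathbf{x}_i)+(1-y_i)\log\big(1-\sigma(\mathbf{w}^\top\mathbf{x}_i)\big)\Big]-L^\ast,$$ where $L^\ast$ is the constant such that the minimum of $L^1$ over $\mathbb{R}^d$ is $0$. The vector $\mathbf{w}_\ast$ is the parameter of a teacher linear classifier, and $\mathbf{w}(\tau)$ is the parameter of a directly parameterized (one-layer) linear student with no capacity restriction. *)

(* Defs.v *)
From HB Require Import structures.
From mathcomp Require Import all_boot all_order all_algebra.
From mathcomp Require Import ring lra.
From mathcomp Require Import all_classical all_reals all_analysis.

Set Implicit Arguments.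
Unset Strict Implicit.
Unset Printing Implicit Defensive.

Import Order.TTheory GRing.Theory Num.Theory.
Import numFieldNormedType.Exports.

Local Open Scope classical_set_scope.
Local Open Scope ring_scope.

(* Vectors of R^d are row vectors, so that the span of a family is the row
   space of the matrix whose rows are the members of the family. *)
Definition dotv (R : realType) (d : nat) (u v : 'rV[R]_d) : R :=
  \sum_(j < d) u 0 j * v 0 j.

Definition sigmoid (R : realType) (u : R) : R := 1 / (1 + expR (- u)).

Definition cross_entropy (R : realType) (n d : nat)
    (x : 'I_n -> 'rV[R]_d) (y : 'I_n -> R) (w : 'rV[R]_d) : R :=
  - (1 / n%:R * \sum_(i < n)
      (y i * ln (sigmoid (dotv w (x i)))
       + (1 - y i) * ln (1 - sigmoid (dotv w (x i))))).

(* The infimum is a minimum for labels produced by a teacher; see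
   [normalized_loss_min] below. *)
Definition normalized_loss (R : realType) (n d : nat)
    (x : 'I_n -> 'rV[R]_d) (y : 'I_n -> R) (w : 'rV[R]_d) : R :=
  cross_entropy x y w - inf (range (cross_entropy x y)).

Definition gradient (R : realType) (d : nat) (f : 'rV[R]_d -> R)
    (w : 'rV[R]_d) : 'rV[R]_d :=
  \row_(j < d) 'D_(delta_mx 0 j) f w.

(* Solutions live on [0, +oo[: only the values of w there matter, and the
   derivative at 0 is the one from the right. *)
Definition gradient_flow (R : realType) (d : nat) (f : 'rV[R]_d -> R)
    (w0 : 'rV[R]_d) (w : R -> 'rV[R]_d) : Prop :=
  [/\ w 0 = w0,
      h^-1 *: (w h - w 0) @[h --> 0^'+] --> - gradient f (w 0)
    & forall t : R, 0 < t -> is_derive t 1 w (- gradient f (w t))].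

(* The projector acts by right multiplication.  The row space of
   [kermx X^T] is the orthogonal complement of the row space of [X]. *)
Definition span_proj (R : realType) (n d : nat) (x : 'I_n -> 'rV[R]_d) :
    'M[R]_d :=
  let X := \matrix_(i < n) x i in proj_mx <<X>>%MS (kermx X^T).

Section SanityChecks.
Variables (R : realType) (n d : nat) (x : 'I_n -> 'rV[R]_d).

Lemma dotvE (u v : 'rV[R]_d) : dotv u v = (u *m v^T) 0 0.
Proof. by rewrite mxE; apply: eq_bigr => j _; rewrite mxE. Qed.

Lemma dotv_self_eq0 (u : 'rV[R]_d) : dotv u u = 0 -> u = 0.
Proof.
move=> /eqP; rewrite psumr_eq0 => [|j _]; last by rewrite -expr2 sqr_ge0.
move=> /allP h; apply/rowP => j; rewrite mxE; apply/eqP.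
by have := h j (mem_index_enum _); rewrite /= mulf_eq0 orbb.
Qed.

Lemma span_proj_sub (v : 'rV[R]_d) :
  (v *m span_proj x <= \matrix_(i < n) x i)%MS.
Proof. by apply: submx_trans (proj_mx_sub _ _ _) _; rewrite genmxE. Qed.

Lemma span_proj_orth (v : 'rV[R]_d) (i : 'I_n) :
  dotv (v - v *m span_proj x) (x i) = 0.
Proof.
rewrite /span_proj; set X := (\matrix_(k < n) x k).
have XK0 : (<<X>> :&: kermx X^T = 0)%MS.
  apply/eqP/rowV0P => u; rewrite sub_capmx genmxE.
  case/andP => /submxP[c uc] /sub_kermxP uX; apply: dotv_self_eq0.
  by rewrite dotvE {2}uc trmx_mul mulmxA uX mul0mx mxE.
have vS : (v <= <<X>> + kermx X^T)%MS.
  apply: submx_full; rewrite /row_full.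
  have := mxrank_sum_cap <<X>>%MS (kermx X^T).
  rewrite XK0 mxrank0 addn0 => ->.
  by rewrite genmxE mxrank_ker mxrank_tr subnKC// rank_leq_col.
have : (v - v *m proj_mx <<X>> (kermx X^T) <= kermx X^T)%MS.
  exact: proj_mx_compl_sub.
move=> /sub_kermxP /rowP/(_ i).
by rewrite !mxE => <-; apply: eq_bigr => j _; rewrite !mxE.
Qed.

Lemma sigmoid_itv (u : R) : 0 < sigmoid u < 1.
Proof.
have e0 := expR_gt0 (- u).
have p0 : 0 < 1 + expR (- u) by lra.
by rewrite /sigmoid divr_gt0//= ltr_pdivrMr// mul1r; lra.
Qed.

Lemma cross_entropy_ge (p s : R) : 0 < p < 1 -> 0 < s < 1 ->
  p * ln s + (1 - p) * ln (1 - s) <= p * ln p + (1 - p) * ln (1 - p).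
Proof.
have aux (a b : R) : 0 < a -> 0 < b -> a * ln b - a * ln a <= b - a.
  move=> a0 b0; have ba : 0 < b / a by rewrite divr_gt0.
  rewrite -mulrBr -ln_div ?posrE//.
  have : ln (b / a) <= b / a - 1.
    have := expR_ge1Dx (ln (b / a)); rewrite lnK ?posrE//; lra.
  rewrite -(ler_pM2l a0) => /le_trans; apply.
  by rewrite mulrBr mulr1 mulrCA mulfV ?mulr1// gt_eqF.
move=> /andP[p0 p1] /andP[s0 s1].
have := aux p s p0 s0.
have := aux (1 - p) (1 - s); rewrite !subr_gt0 => /(_ p1 s1); lra.
Qed.

Lemma normalized_loss_min (y : 'I_n -> R) (ws : 'rV[R]_d) :
  (forall i, y i = sigmoid (dotv ws (x i))) ->
  normalized_loss x y ws = 0 /\ forall w, 0 <= normalized_loss x y w.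
Proof.
move=> hy.
have le_ws w : cross_entropy x y ws <= cross_entropy x y w.
  rewrite /cross_entropy lerN2 ler_wpM2l ?divr_ge0//.
  by apply: ler_sum => i _; rewrite hy; apply: cross_entropy_ge;
     exact: sigmoid_itv.
suff infE : inf (range (cross_entropy x y)) = cross_entropy x y ws.
  by rewrite /normalized_loss infE subrr; split => // w; rewrite subr_ge0.
have lb : lbound (range (cross_entropy x y)) (cross_entropy x y ws).
  by move=> _ [w _ <-].
apply/eqP; rewrite eq_le; apply/andP; split.
  by apply: ge_inf; [exists (cross_entropy x y ws) | exists ws].
by apply: lb_le_inf => //; exists (cross_entropy x y ws), ws.
Qed.

End SanityChecks.

(* Main.v *)
(* The gradient of the loss is the average of (sigma(w.x_i) - y_i) x_i, which
   lies in the span of the x_i; so the component of w orthogonal to the span is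
   conserved, and r := w - what stays in the span, where
   what := w0 + P (w* - w0) has what.x_i = w*.x_i.  Since sigma is increasing,
   V := |r|^2 is nonincreasing along the flow; hence all w.x_i stay in a
   bounded interval, on which sigma is
   strongly monotone.  As the sum of the (r.x_i)^2 controls |r|^2 on the span,
   V' <= - mu V for some mu > 0, and V tends to 0. *)
Require Import Defs.
From HB Require Import structures.
From mathcomp Require Import all_boot all_order all_algebra.
From mathcomp Require Import ring lra.
From mathcomp Require Import all_classical all_reals all_analysis.
Import Order.TTheory GRing.Theory Num.Theory.
Import numFieldNormedType.Exports.
Local Open Scope classical_set_scope.
Local Open Scope ring_scope.

Set Implicit Arguments.
Unset Strict Implicit.
Unset Printing Implicit Defensive.

(** * Bilinearity and Cauchy-Schwarz for [dotv] *)

Section DotProduct.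
Context {R : realType} {d : nat}.
Implicit Types u v z : 'rV[R]_d.

Lemma dotvC u v : dotv u v = dotv v u.
Proof. by apply: eq_bigr => j _; rewrite mulrC. Qed.

Lemma dotvDl u v z : dotv (u + v) z = dotv u z + dotv v z.
Proof. by rewrite !dotvE mulmxDl mxE. Qed.

Lemma dotvNl u z : dotv (- u) z = - dotv u z.
Proof. by rewrite !dotvE mulNmx mxE. Qed.

Lemma dotvBl u v z : dotv (u - v) z = dotv u z - dotv v z.
Proof. by rewrite dotvDl dotvNl. Qed.

Lemma dotvZl (a : R) u z : dotv (a *: u) z = a * dotv u z.
Proof. by rewrite !dotvE -scalemxAl mxE. Qed.

Lemma dotvBr u v z : dotv z (u - v) = dotv z u - dotv z v.
Proof. by rewrite !(dotvC z) dotvBl. Qed.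

Lemma dotvZr (a : R) u z : dotv z (a *: u) = a * dotv z u.
Proof. by rewrite !(dotvC z) dotvZl. Qed.

Lemma dotv_suml n (F : 'I_n -> 'rV[R]_d) z :
  dotv (\sum_i F i) z = \sum_i dotv (F i) z.
Proof.
by rewrite dotvE mulmx_suml summxE; apply: eq_bigr => i _; rewrite dotvE.
Qed.

Lemma dotv_ge0 u : 0 <= dotv u u.
Proof. by apply: sumr_ge0 => j _; rewrite -expr2 sqr_ge0. Qed.

Lemma sqr_coord_le_dotv u j : u 0 j ^+ 2 <= dotv u u.
Proof.
rewrite /dotv (bigD1 j)//= expr2 lerDl.
by apply: sumr_ge0 => k _; rewrite -expr2 sqr_ge0.
Qed.

Lemma dotv_CauchySchwarz u v : dotv u v ^+ 2 <= dotv u u * dotv v v.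
Proof.
have [/dotv_self_eq0 ->|vv0] := eqVneq (dotv v v) 0.
  by rewrite -(subrr u) !dotvBr !dotvBl !subrr expr0n/= !mulr0.
have vv_gt0 : 0 < dotv v v by rewrite lt_def vv0 dotv_ge0.
have := dotv_ge0 (dotv v v *: u - dotv u v *: v).
rewrite !(dotvBl, dotvBr, dotvZl, dotvZr) (dotvC v u) => h.
by rewrite -subr_ge0 -(pmulr_rge0 _ vv_gt0); apply: le_trans h _; lra.
Qed.

End DotProduct.

Lemma dotv_mulmx_bounded {R : realType} {n d : nat} (M : 'M[R]_(n, d)) :
  exists2 K : R, 0 < K &
    forall z : 'rV[R]_n, dotv (z *m M) (z *m M) <= K * dotv z z.
Proof.
pose c (j : 'I_d) := (col j M)^T.
(* The sum is the squared Frobenius norm of [M]; adding 1 keeps the constant positive when [M] is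
   zero. *)
exists (1 + \sum_j dotv (c j) (c j)).
  by rewrite ltr_pwDl// sumr_ge0// => j _; exact: dotv_ge0.
move=> z; rewrite mulrDl mul1r.
suff : dotv (z *m M) (z *m M) <= (\sum_j dotv (c j) (c j)) * dotv z z.
  by have := dotv_ge0 z; lra.
rewrite mulr_suml; apply: ler_sum => j _.
have -> : (z *m M) 0 j = dotv z (c j).
  by rewrite mxE; apply: eq_bigr => i _; rewrite !mxE.
by rewrite -expr2 mulrC; exact: dotv_CauchySchwarz.
Qed.

(** * The projector and coercivity on the span *)

Section SpanProjection.
Context {R : realType} {n d : nat} (x : 'I_n -> 'rV[R]_d).

Lemma dotv_span_orth (u v : 'rV[R]_d) : (u <= \matrix_(i < n) x i)%MS ->
  (forall i, dotv v (x i) = 0) -> dotv u v = 0.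
Proof.
move=> /submxP[c ->] vx; rewrite mulmx_sum_row dotv_suml big1// => i _.
by rewrite dotvZl rowK dotvC vx mulr0.
Qed.

(** The residual [r - r *m span_proj x] is orthogonal to every [x i], hence to [r] by hypothesis and
    to the projection, which lies in the span. It is therefore orthogonal to itself. *)
Lemma span_proj_eq (r : 'rV[R]_d) :
  (forall v, (forall i, dotv v (x i) = 0) -> dotv r v = 0) ->
  r *m span_proj x = r.
Proof.
move=> r_orth; apply/esym/eqP; rewrite -subr_eq0; apply/eqP.
have vx := span_proj_orth x r; apply: dotv_self_eq0.
by rewrite dotvBl r_orth// dotv_span_orth ?subrr//; exact: span_proj_sub.
Qed.

Lemma dotv_span_proj (u : 'rV[R]_d) i :
  dotv (u *m span_proj x) (x i) = dotv u (x i).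
Proof. by apply/esym/eqP; rewrite -subr_eq0 -dotvBl span_proj_orth. Qed.

(* On the span of the [x i], [r] is recovered from the vector of the
   [dotv r (x i)] by a fixed linear map. *)
Lemma span_coercive : exists2 m : R, 0 < m &
  forall r : 'rV[R]_d, r *m span_proj x = r ->
    m * dotv r r <= \sum_i dotv r (x i) ^+ 2.
Proof.
set X := \matrix_(i < n) x i.
have mulXT (u : 'rV[R]_d) i : (u *m X^T) 0 i = dotv u (x i).
  by rewrite mxE; apply: eq_bigr => j _; rewrite !mxE.
have [K K0 leK] := dotv_mulmx_bounded (pinvmx X^T *m span_proj x).
exists K^-1; first by rewrite invr_gt0.
(* [q] need not lie in the span, but it has the same inner products with the [x i] as [r], so its
   projection is [r]. *)
move=> r rP; pose z := r *m X^T; pose q := z *m pinvmx X^T.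
have qX : q *m X^T = r *m X^T by rewrite mulmxKpV// submxMl.
suff rE : r = z *m (pinvmx X^T *m span_proj x).
  rewrite mulrC ler_pdivrMr// mulrC {1 2}rE; apply: le_trans (leK z) _.
  rewrite (ler_wpM2l (ltW K0))//; apply: ler_sum => i _.
  by rewrite mulXT -expr2.
apply/eqP; rewrite mulmxA -/q -subr_eq0 -{1}rP -mulmxBl; apply/eqP.
apply: dotv_self_eq0; apply: dotv_span_orth; first exact: span_proj_sub.
by move=> i; rewrite dotv_span_proj dotvBl -!mulXT qX subrr.
Qed.

End SpanProjection.

(** * Monotonicity of the sigmoid and derivative of the log-likelihood *)

Section Sigmoid.
Context {R : realType}.

(** Over a common denominator, the difference of sigmoids has numerator e^(-a) (e^(a-b) - 1), at
    least e^(-B) (a - b) when b <= a, and denominator at most (1 + e^B)^2. *)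
Lemma sigmoid_strongly_monotone (B a b : R) : `|a| <= B -> `|b| <= B ->
  expR (- B) / (1 + expR B) ^+ 2 * (a - b) ^+ 2 <=
  (sigmoid a - sigmoid b) * (a - b).
Proof.
wlog ba : a b / b <= a => [H aB bB|].
  have [/H|/ltW /H] := lerP b a; first exact.
  by move=> /(_ bB aB); congr is_true; congr (_ <= _); ring.
move=> /[!ler_norml] /andP[aB1 aB2] /andP[bB1 bB2].
have ea := expR_gt0 (- a); have eb := expR_gt0 (- b); have eB := expR_gt0 B.
have -> : sigmoid a - sigmoid b =
    (expR (- b) - expR (- a)) / ((1 + expR (- a)) * (1 + expR (- b))).
  by rewrite /sigmoid; field; rewrite !gt_eqF//; lra.
rewrite [(a - b) ^+ 2]expr2 mulrA ler_wpM2r ?subr_ge0//.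
have eab : expR (- B) * (a - b) <= expR (- b) - expR (- a).
  have -> : expR (- b) = expR (- a) * expR (a - b).
    by rewrite -expRD; congr expR; lra.
  rewrite -{2}[expR (- a)]mulr1 -mulrBr ler_pM ?expR_ge0 ?subr_ge0//.
    by rewrite ler_expR lerN2.
  by have := expR_ge1Dx (a - b); lra.
rewrite mulrAC ler_pM ?mulr_ge0 ?expR_ge0 ?subr_ge0 ?invr_ge0 ?sqr_ge0//.
rewrite lef_pV2 ?posrE ?exprn_gt0 ?mulr_gt0 ?addr_gt0//.
by rewrite expr2 ler_pM ?addr_ge0 ?expR_ge0// lerD2l ler_expR; lra.
Qed.

(** As 1 - sigma(u) = e^(-u) sigma(u), both logarithms reduce to a single one, which makes
    differentiation short. *)
Lemma log_likelihoodE (p u : R) :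
  p * ln (sigmoid u) + (1 - p) * ln (1 - sigmoid u) =
  - ln (1 + expR (- u)) - (1 - p) * u.
Proof.
have e0 := expR_gt0 (- u).
have -> : 1 - sigmoid u = expR (- u) / (1 + expR (- u)).
  by rewrite /sigmoid; field; rewrite gt_eqF//; lra.
rewrite /sigmoid div1r lnV ?posrE ?addr_gt0//.
by rewrite ln_div ?posrE ?addr_gt0// expRK; ring.
Qed.

Lemma is_derive_log_likelihood (p u : R) :
  is_derive u (1 : R)
    (fun t => p * ln (sigmoid t) + (1 - p) * ln (1 - sigmoid t))
    (p - sigmoid u).
Proof.
have e0 := expR_gt0 (- u).
under eq_fun do rewrite log_likelihoodE.
have e1 : 0 < 1 + expR (- u) by rewrite addr_gt0.
have h1 : is_derive u (1 : R) (fun t => 1 + expR (- t)) (- expR (- u)).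
  have := is_deriveD (is_derive_cst (1 : R) u 1)
    (is_derive1_comp (is_derive_expR (- u)) (is_deriveNid u (1 : R))).
  by move=> /is_derive_eq; apply; rewrite add0r mulrN1.
have := is_deriveB
  (is_deriveN (@is_derive1_comp R (@ln R) _ u _ _ (is_derive1_ln e1) h1))
  (is_deriveZ (1 - p) (is_derive_id u (1 : R))).
move=> /is_derive_eq; apply.
by rewrite /sigmoid /GRing.scale/=; field; rewrite gt_eqF.
Qed.

End Sigmoid.

(** * The gradient of the loss *)

Lemma derive_lineE {R : realType} {V : normedModType R} (f : V -> R) (a v : V) :
  'D_v f a = 'D_1 (fun h : R => f (h *: v + a)) 0.
Proof.
have E : (fun h : R => h^-1 *: ((f \o shift a) (h *: v) - f a)) =
    (fun h => h^-1 *: (((fun k : R => f (k *: v + a)) \o shift 0) (h *: 1)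
                       - f (0 *: v + a))).
  by apply/funext => h /=; rewrite [h *: 1]mulr1 addr0 scale0r add0r.
by rewrite /derive E.
Qed.

(** Along the [j]-th basis direction each [dotv w (x i)] varies affinely with slope [x i 0 j], so
    the chain rule in one variable suffices; the subtracted infimum is a constant. *)
Lemma gradient_normalized_loss {R : realType} {n d : nat}
    (x : 'I_n -> 'rV[R]_d) (y : 'I_n -> R) (w : 'rV[R]_d) :
  gradient (normalized_loss x y) w =
  n%:R^-1 *: \sum_i (sigmoid (dotv w (x i)) - y i) *: x i.
Proof.
apply/rowP => j; rewrite !mxE summxE derive_lineE; set e := delta_mx 0 j.
pose l i (u : R) := y i * ln (sigmoid u) + (1 - y i) * ln (1 - sigmoid u).
have dl i : is_derive (0 : R) (1 : R) (fun h => l i (dotv (h *: e + w) (x i)))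
    ((y i - sigmoid (dotv w (x i))) * x i 0 j).
  have -> : (fun h => l i (dotv (h *: e + w) (x i))) =
      l i \o (fun h => h * x i 0 j + dotv w (x i)).
    apply/funext => h /=; congr (l i _).
    rewrite dotvDl dotvZl; congr (_ * _ + _).
    rewrite /dotv (bigD1 j)//= big1 ?mxE ?eqxx ?mul1r ?addr0// => k kj.
    by rewrite mxE (negPf kj) andbF mul0r.
  apply: is_derive1_comp.
    by rewrite mul0r add0r; exact: is_derive_log_likelihood.
  have := is_deriveD (is_deriveZ (x i 0 j) (is_derive_id (0 : R) (1 : R)))
    (is_derive_cst (dotv w (x i)) (0 : R) (1 : R)).
  rewrite addr0 /GRing.scale/= mulr1; congr (is_derive _ _ _ _).
  by apply/funext => h /=; rewrite [LHS]/= /cst mulrC.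
have := is_deriveB (is_deriveN (is_deriveZ n%:R^-1 (is_derive_sum dl)))
  (is_derive_cst (inf (range (cross_entropy x y))) (0 : R) (1 : R)).
move=> /@derive_val; rewrite subr0 -[_ *: _]/(_ * _) => dE.
transitivity (- (n%:R^-1 * \sum_i
    (y i - sigmoid (dotv w (x i))) * x i 0 j)); last first.
  rewrite -mulrN -sumrN; congr (_ * _).
  by apply: eq_bigr => i _; rewrite !mxE; ring.
apply: etrans dE; apply: (congr1 (fun F : R -> R => derive F 0 1)).
by apply/funext => h; rewrite /normalized_loss /cross_entropy div1r fct_sumE.
Qed.

Lemma dotv_gradient_normalized_loss {R : realType} {n d : nat}
    (x : 'I_n -> 'rV[R]_d) (y : 'I_n -> R) (u v : 'rV[R]_d) :
  dotv (gradient (normalized_loss x y) u) v =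
  n%:R^-1 * \sum_i (sigmoid (dotv u (x i)) - y i) * dotv v (x i).
Proof.
rewrite gradient_normalized_loss dotvZl dotv_suml; congr (_ * _).
by apply: eq_bigr => i _; rewrite dotvZl (dotvC v).
Qed.

(** * Calculus along curves and decay from a differential inequality *)

Lemma continuous_dotv {R : realType} {d : nat} (v : 'rV[R]_d) :
  continuous (fun u => dotv u v).
Proof.
move=> u; apply: (cvg_big (@add_continuous R) (nbhs_filter u)) => j _.
by apply: cvgMr_tmp; exact: coord_continuous.
Qed.

Lemma is_derive_dotv {R : realType} {d : nat} (u v : R -> 'rV[R]_d)
    (t : R) (du dv : 'rV[R]_d) :
  is_derive t (1 : R) u du -> is_derive t (1 : R) v dv ->
  is_derive t (1 : R) (fun s => dotv (u s) (v s))
    (dotv du (v t) + dotv (u t) dv).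
Proof.
have coord (f : R -> 'rV[R]_d) df j : is_derive t (1 : R) f df ->
    is_derive t (1 : R) (fun s => f s 0 j) (df 0 j).
  move=> [fd <-]; split; first exact: (derivable_mxP _ _ _).1.
  by rewrite derive_mx// mxE.
move=> hu hv.
have := is_derive_sum (fun j => is_deriveM (coord u du j hu) (coord v dv j hv)).
rewrite fct_sumE => /is_derive_eq; apply.
rewrite /dotv -big_split/=; apply: eq_bigr => j _.
by rewrite -![_ *: _]/(_ * _); ring.
Qed.

(** Mean value theorem. The half-line is open at [a] because a gradient flow is given a two-sided
    derivative at positive times only. *)
Lemma is_derive_le0_nincr {R : realType} (f df : R -> R) (a s t : R) :
  (forall r, a < r -> is_derive r (1 : R) f (df r)) ->
  (forall r, a < r -> df r <= 0) -> a < s -> s <= t -> f t <= f s.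
Proof.
move=> fdf df0 a_s st.
have [||c /[!in_itv]/= /andP[sc _] E] := @MVT_segment R f df s t st.
- by move=> r /[!in_itv]/= /andP[sr _]; exact/fdf/(lt_trans a_s).
- apply: derivable_within_continuous => r; rewrite in_itv/= => /andP[sr _].
  by have [] := fdf r (lt_le_trans a_s sr).
- rewrite -subr_le0 E mulr_le0_ge0 ?subr_ge0//.
  by apply: df0; exact: lt_le_trans sc.
Qed.

(** Grönwall argument: the integrating factor e^(mu t) turns the inequality into monotonicity of
    [f]. *)
Lemma exp_decay_cvg0 {R : realType} (V dV : R -> R) (a mu : R) : 0 < mu ->
  (forall t, a < t -> is_derive t (1 : R) V (dV t)) ->
  (forall t, a < t -> dV t <= - mu * V t) ->
  (forall t, 0 <= V t) -> V t @[t --> +oo] --> (0 : R).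
Proof.
move=> mu0 VdV dVle V0.
pose f t := expR (mu * t) * V t.
pose df t := expR (mu * t) * (mu * V t + dV t).
have fdf t : a < t -> is_derive t (1 : R) f (df t).
  move=> /VdV Vt.
  have := is_deriveM (@is_derive1_comp R expR ( *%R mu) t _ _
    (is_derive_expR (mu * t)) (is_deriveZ mu (is_derive_id t (1 : R)))) Vt.
  by move=> /is_derive_eq; apply; rewrite /df -![_ *: _]/(_ * _) /=; ring.
have df0 t : a < t -> df t <= 0.
  by move=> /dVle le; rewrite /df mulr_ge0_le0 ?expR_ge0//; lra.
set C := f (a + 1).
apply/cvgrPdist_le => e e0; near=> t.
rewrite sub0r normrN ger0_norm//.
have t0 : 0 < t by near: t; exact: nbhs_pinfty_gt.
have at1 : a + 1 <= t by near: t; exact/nbhs_pinfty_ge/num_real.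
have Ct : C / (mu * e) <= t by near: t; exact/nbhs_pinfty_ge/num_real.
have ftC : f t <= C by apply: is_derive_le0_nincr fdf df0 _ at1; rewrite ltrDl.
rewrite ler_pdivrMr ?mulr_gt0// in Ct.
(* A linear lower bound on the exponential is enough: it gives V(t) <= C / (mu t), hence at most [e]
   by [Ct]. *)
have et : mu * t <= expR (mu * t) by have := expR_ge1Dx (mu * t); lra.
rewrite -(ler_pM2l (mulr_gt0 mu0 t0)).
have : mu * t * V t <= f t by rewrite ler_wpM2r.
by lra.
Unshelve. all: by end_near. Qed.

(** * Conservation of the component orthogonal to the data *)

Section Flow.
Context {R : realType} {n d : nat} (x : 'I_n -> 'rV[R]_d) (y : 'I_n -> R).
Context (w0 : 'rV[R]_d) (w : R -> 'rV[R]_d).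
Hypothesis flow : gradient_flow (normalized_loss x y) w0 w.

Lemma is_derive_flow_dotv (v : 'rV[R]_d) (t : R) : 0 < t ->
  is_derive t (1 : R) (fun s => dotv (w s) v)
    (- dotv (gradient (normalized_loss x y) (w t)) v).
Proof.
case: flow => _ _ /[apply] dw.
have := is_derive_dotv dw (is_derive_cst v t (1 : R)).
move=> /is_derive_eq; apply.
by rewrite dotvNl -[X in dotv (w t) X](subrr v) dotvBr subrr addr0.
Qed.

Lemma flow_dotv_orth (v : 'rV[R]_d) (t : R) :
  (forall i, dotv v (x i) = 0) -> 0 < t ->
  dotv (w t) v = dotv w0 v.
Proof.
move=> vx t0.
have d0 (s : R) : 0 < s -> is_derive s (1 : R) (fun s => dotv (w s) v) 0.
  move=> /(is_derive_flow_dotv v) /is_derive_eq; apply.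
  rewrite dotv_gradient_normalized_loss big1 ?mulr0 ?oppr0// => i _.
  by rewrite vx mulr0.
have d0N (s : R) : 0 < s -> is_derive s (1 : R) (fun s => - dotv (w s) v) 0.
  by move=> /d0 /is_deriveN; rewrite oppr0.
have const s : 0 < s -> dotv (w s) v = dotv (w t) v.
  move=> s0; wlog st : s t s0 t0 / s <= t => [H|].
    by have [/H|/ltW /H] := lerP s t => [|<-//]; apply.
  apply/eqP; rewrite eq_le; apply/andP; split.
    by have := is_derive_le0_nincr d0N (fun _ _ => lexx 0) s0 st; rewrite lerN2.
  exact: is_derive_le0_nincr d0 (fun _ _ => lexx 0) s0 st.
case: flow => w00 dw _.
(* Multiplying the difference quotient at [0^+] by [h] gives continuity. *)
have h0 : h @[h --> (0 : R)^'+] --> (0 : R) by exact: cvg_within.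
have := cvgM h0 (cvg_comp _ _ dw (@continuous_dotv R d v _)).
rewrite mul0r => lim0; apply/eqP; rewrite -subr_eq0; apply/eqP.
refine (norm_cvg_unique _ (lim0 _)); apply: cvg_near_cst; near=> h.
have h_gt0 : 0 < h by [].
by rewrite /= dotvZl dotvBl w00 const// mulrA mulfV ?gt_eqF// mul1r.
Unshelve. all: by end_near. Qed.

End Flow.

Theorem theorem6p1 (R : realType) (n d : nat) (hn : (0 < n)%N)
    (wstar : 'rV[R]_d) (hwstar : wstar <> 0)
    (x : 'I_n -> 'rV[R]_d) (y : 'I_n -> R)
    (hy : forall i, y i = sigmoid (dotv wstar (x i)))
    (w0 : 'rV[R]_d) (w : R -> 'rV[R]_d)
    (hw : gradient_flow (normalized_loss x y) w0 w) :
  w t @[t --> +oo] --> w0 + (wstar - w0) *m span_proj x.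
Proof.
set what := w0 + _.
have what_x i : dotv what (x i) = dotv wstar (x i).
  by rewrite dotvDl dotv_span_proj dotvBl; ring.
pose r t := w t - what; pose V t := dotv (r t) (r t).
have r_x t i : dotv (r t) (x i) = dotv (w t) (x i) - dotv wstar (x i).
  by rewrite dotvBl what_x.
(* The contribution of sample [i] to the decrease of [V]. *)
pose gap t i := (sigmoid (dotv (w t) (x i)) - sigmoid (dotv wstar (x i)))
  * dotv (r t) (x i).
pose dV t := - (2 / n%:R) * \sum_i gap t i.
have VdV (t : R) : 0 < t -> is_derive t (1 : R) V (dV t).
  case: hw => _ _ /[apply] dw.
  have dr := is_deriveB dw (is_derive_cst what t (1 : R)).
  have := is_derive_dotv dr dr; move=> /is_derive_eq; apply.
  rewrite subr0 (dotvC _ (- _)) dotvNl dotv_gradient_normalized_loss.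
  rewrite /dV /gap; under eq_bigr do rewrite hy.
  by rewrite /r; ring.
have n0 : 0 < n%:R :> R by rewrite ltr0n.
have n2 : 0 < 2 / n%:R :> R by rewrite divr_gt0.
have gap_lb B t i : `|dotv (w t) (x i)| <= B -> `|dotv wstar (x i)| <= B ->
    expR (- B) / (1 + expR B) ^+ 2 * dotv (r t) (x i) ^+ 2 <= gap t i.
  by rewrite /gap r_x; exact: sigmoid_strongly_monotone.
have cB (B : R) : 0 < expR (- B) / (1 + expR B) ^+ 2.
  by rewrite divr_gt0 ?expR_gt0// exprn_gt0// addr_gt0 ?expR_gt0.
have gap_ge0 t i : 0 <= gap t i.
  (* Only the sign is wanted here, so a bound depending on [t] and [i] will do; a uniform one comes
     later, from the monotonicity of [V]. *)
  pose B := `|dotv (w t) (x i)| + `|dotv wstar (x i)|.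
  apply: le_trans (gap_lb B t i _ _); rewrite ?lerDl ?lerDr//.
  by rewrite mulr_ge0 ?sqr_ge0// ltW.
(* Time 1 serves as the reference because [VdV] holds at positive times only. *)
have V_le (t : R) : 1 < t -> V t <= V 1.
  move=> t1; apply: is_derive_le0_nincr VdV _ ltr01 (ltW t1) => s _.
  by rewrite /dV mulNr oppr_le0 mulr_ge0 ?(ltW n2)// sumr_ge0.
have [m m0 coercive] := span_coercive x.
(* Both [w t] and [what] have the same component orthogonal to the span as [w0]. *)
have rP (t : R) : 0 < t -> r t *m span_proj x = r t.
  move=> t0; apply: span_proj_eq => v vx; rewrite dotvBl dotvDl.
  rewrite (flow_dotv_orth hw vx t0) (dotv_span_orth (span_proj_sub _ _) vx).
  by rewrite addr0 subrr.
(* A bound uniform in [t > 1] and [i]: the first two terms bound [dotv (r t) (x i)], the last one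
   the teacher's value. *)
pose B := 1 + V 1 * (\sum_i dotv (x i) (x i)) + \sum_i `|dotv wstar (x i)|.
have xx_ge0 i : 0 <= dotv (x i) (x i) by exact: dotv_ge0.
have sumx_ge (F : 'I_n -> R) i : (forall j, 0 <= F j) -> F i <= \sum_j F j.
  by move=> F0; rewrite (bigD1 i)//= lerDl sumr_ge0.
have wstar_B i : `|dotv wstar (x i)| <= \sum_j `|dotv wstar (x j)|.
  exact: (sumx_ge (fun j => `|dotv wstar (x j)|)).
have r_B (t : R) i : 1 < t ->
    `|dotv (r t) (x i)| <= 1 + V 1 * \sum_j dotv (x j) (x j).
  move=> t1; set q := `|_|.
  have q2 : q ^+ 2 <= V 1 * \sum_j dotv (x j) (x j).
    rewrite /q real_normK ?num_real//.
    apply: le_trans (dotv_CauchySchwarz _ _) _.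
    apply: ler_pM; rewrite ?dotv_ge0 ?V_le//.
    exact: (sumx_ge (fun j => dotv (x j) (x j))).
  (* q <= 1 + q^2 avoids a square root and explains the 1 in [B]. *)
  by have := sqr_ge0 (q - 1); have := sqr_ge0 q; lra.
set c := expR (- B) / (1 + expR B) ^+ 2.
have decay (t : R) : 1 < t -> dV t <= - (2 / n%:R * c * m) * V t.
  move=> t1; rewrite /dV !mulNr lerN2.
  have -> : 2 / n%:R * c * m * V t = 2 / n%:R * (c * (m * V t)) by ring.
  rewrite (ler_wpM2l (ltW n2))//.
  apply: le_trans (_ : c * \sum_i dotv (r t) (x i) ^+ 2 <= _).
    by rewrite ler_wpM2l ?(ltW (cB B))// coercive// rP// (lt_trans ltr01).
  rewrite mulr_sumr; apply: ler_sum => i _; apply: gap_lb.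
    have -> : dotv (w t) (x i) = dotv (r t) (x i) + dotv wstar (x i).
      by rewrite r_x subrK.
    by apply: le_trans (ler_normD _ _) _; rewrite lerD ?r_B.
  apply: le_trans (wstar_B i) _; rewrite lerDr addr_ge0// mulr_ge0 ?dotv_ge0//.
  exact: sumr_ge0.
have V_cvg0 : V t @[t --> +oo] --> (0 : R).
  apply: (@exp_decay_cvg0 _ V dV 1 _ _ _ decay) => [|t t1|t].
  - exact: mulr_gt0 (mulr_gt0 n2 (cB B)) m0.
  - by apply: VdV; exact: lt_trans ltr01 t1.
  - exact: dotv_ge0.
apply/cvgrPdist_le => e e0.
have e20 : 0 < e ^+ 2 by rewrite exprn_gt0.
move/cvgrPdist_le : V_cvg0 => /(_ _ e20); apply: filterS => t.
rewrite sub0r normrN ger0_norm ?dotv_ge0// => Vt.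
(* The norm on row vectors is the maximum norm, and the square of each coordinate of [r t] is at
   most V(t) <= e^2. *)
rewrite distrC [leLHS]/Num.norm/= mx_normrE.
apply: bigmax_le => [|[i j] _]; first exact: ltW.
rewrite ord1 -(@ler_pXn2r _ 2)// ?nnegrE ?(ltW e0)// real_normK ?num_real//.
exact: le_trans (sqr_coord_le_dotv _ _) Vt.
Qed.
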